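(* Every double-critical $6$-chromatic graph $G$ contains $K_6$ as a minor.
   Context: All graphs are finite and simple. A graph $G$ is (vertex-)critical if $\chi(G-v)<\chi(G)$ for every vertex $v\in V(G)$. A critical graph $G$ is double-critical if $\chi(G-x-y)\le\chi(G)-2$ for every edge $xy\in E(G)$. $K_n$ denotes the complete graph on $n$ vertices. A graph $H$ is a minor of $G$ if $H$ can be obtained from $G$ by deleting edges and/or vertices and contracting edges. *)

(* Defs.v *)
From mathcomp Require Import all_boot.
Set Implicit Arguments. Unset Strict Implicit. Unset Printing Implicit Defensive.

Section Graphs.
Variable T : finType.

Definition simple_graph (e : rel T) : Prop := symmetric e /\ irreflexive e.

Definition colorable (e : rel T) (S : {set T}) (k : nat) : bool :=
  [exists f : {ffun T -> 'I_k},
     [forall x, forall y, [&& x \in S, y \in S & e x y] ==> (f x != f y)]].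

Lemma colorable_card (e : rel T) (S : {set T}) (ir : irreflexive e) :
  exists k, colorable e S k.
Proof.
exists #|T|; apply/existsP; exists [ffun x => enum_rank x].
apply/forallP => x; apply/forallP => y; apply/implyP => /and3P [_ _ exy].
rewrite !ffunE; apply/negP => /eqP /enum_rank_inj exy'.
by move: exy; rewrite exy' ir.
Qed.

Definition chi (e : rel T) (ir : irreflexive e) (S : {set T}) : nat :=
  ex_minn (colorable_card S ir).

Definition chiG (e : rel T) (ir : irreflexive e) : nat := chi ir [set: T].

Definition critical (e : rel T) (ir : irreflexive e) : Prop :=
  forall v : T, chi ir (~: [set v]) < chiG ir.

Definition double_critical (e : rel T) (ir : irreflexive e) : Prop :=
  critical ir /\
  forall x y : T, e x y -> chi ir (~: [set x; y]) <= chiG ir - 2.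

Definition connected_in (e : rel T) (B : {set T}) : Prop :=
  forall x y, x \in B -> y \in B ->
    connect [rel u v | [&& e u v, u \in B & v \in B]] x y.

(* K_n is a minor of G, via the standard branch-set model: n pairwise disjoint,
   nonempty, connected vertex sets, any two of which are joined by an edge. *)
Definition has_Kn_minor (e : rel T) (n : nat) : Prop :=
  exists B : 'I_n -> {set T},
    [/\ forall i, B i != set0,
        forall i, connected_in e (B i),
        forall i j, i != j -> [disjoint B i & B j] &
        forall i j, i != j -> exists x y, [/\ x \in B i, y \in B j & e x y]].

End Graphs.

(* Main.v *)
Require Import Defs.
From mathcomp Require Import all_boot.
From mathcomp Require Import fingroup perm.
From mathcomp Require Import zify.
Set Implicit Arguments. Unset Strict Implicit. Unset Printing Implicit Defensive.

(* In a double-critical 6-chromatic graph every edge xy lies in at least four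
   triangles: if some colour class of a 4-colouring of G - x - y contained no
   common neighbour of x and y, then x could take over that colour, its
   neighbours of that colour moving to a new class together with y.

   Let every edge lie in four triangles and let 0 < deg v < 8.  The link of v has
   at most 7 vertices and minimum degree at least 4.  Either it has a K5 minor, or
   it is the octahedron or the pentagonal bipyramid.  In the latter cases some
   link edge lies in at most two triangles of the link, so there is a vertex outside
   N[v]; let C be its component in G - N[v].  If C sees two nonadjacent vertices
   of the link, contracting C into one of them adds an edge to the link, which
   then has a K5 minor; otherwise C is cut off by a clique of size at most 3.

   By induction this dichotomy gives a version of Mader's theorem: n >= 3 vertices
   and at least 4n - 8 edges force a K6 minor (contract an edge lying in at most
   three triangles; count edges across a clique separator).  If G is sparser than
   that, it has a vertex of degree less than 8, and the dichotomy applies to G itself,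
   since a critical graph has no clique separator. *)

(** * Exhaustive search over graphs on 5, 6 or 7 vertices with minimum degree at least 4 *)

(* Under [vm_compute] both arguments of [||] and [&&] are evaluated, so [has],
   [all] and [pairwise] do not stop early; these variants do. *)
Fixpoint lall A (p : pred A) (s : seq A) : bool :=
  if s is x :: s' then if p x then lall p s' else false else true.

Fixpoint lhas A (p : pred A) (s : seq A) : bool :=
  if s is x :: s' then if p x then true else lhas p s' else false.

Lemma lallE A (p : pred A) s : lall p s = all p s.
Proof. by elim: s => //= x s ->; case: (p x). Qed.

Lemma lhasE A (p : pred A) s : lhas p s = has p s.
Proof. by elim: s => //= x s ->; case: (p x). Qed.

Fixpoint lpairwise A (r : rel A) (s : seq A) : bool :=
  if s is x :: s' then if lall (r x) s' then lpairwise r s' else false else true.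

Lemma lpairwiseE A (r : rel A) s : lpairwise r s = pairwise r s.
Proof. by elim: s => //= x s ->; rewrite lallE; case: (all _ _). Qed.

Definition tab (m : nat) (r : rel nat) : seq (seq bool) :=
  mkseq (fun i => mkseq (r i) m) m.

Definition tadj (M : seq (seq bool)) : rel nat :=
  fun i j => nth false (nth [::] M i) j.

Lemma tadj_tab m r i j : tadj (tab m r) i j = [&& i < m, j < m & r i j].
Proof.
rewrite /tadj /tab; case: (ltnP i m) => im; last first.
  by rewrite (nth_default [::]) ?size_mkseq // nth_nil.
rewrite nth_mkseq //; case: (ltnP j m) => jm; first by rewrite nth_mkseq.
by rewrite nth_default // size_mkseq.
Qed.

Lemma eq_tab m (r r' : rel nat) :
  (forall i j, i < m -> j < m -> r i j = r' i j) -> tab m r = tab m r'.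
Proof.
move=> rr'; apply: (@eq_from_nth _ [::]); rewrite !size_mkseq // => i im.
rewrite !nth_mkseq //; apply: (@eq_from_nth _ false); rewrite !size_mkseq // => j jm.
by rewrite !nth_mkseq // rr'.
Qed.

Definition add_edge (a b : nat) (r : rel nat) : rel nat :=
  fun i j => [|| r i j, (i == a) && (j == b) | (i == b) && (j == a)].

(* The set partitions of [s]; a minor model on [s] is a partition into branch sets. *)
Fixpoint partitions (s : seq nat) : seq (seq (seq nat)) :=
  if s is i :: s' then
    flatten [seq ([:: i] :: P) ::
               [seq set_nth [::] P k (i :: nth [::] P k) | k <- iota 0 (size P)]
            | P <- partitions s']
  else [:: [::]].

Definition partitions5 (m : nat) : seq (seq (seq nat)) :=
  [seq P <- partitions (iota 0 m) | size P == 5].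

(** Each bag has to be a clique: this is stronger than connectedness, easy to test, and still enough
    for the search to succeed. *)
Definition K5_bags (r : rel nat) (P : seq (seq nat)) : bool :=
  if lall (lpairwise r) P then
    lpairwise (fun A B => lhas (fun i => lhas (r i) B) A) P
  else false.

(* The octahedron and the pentagonal bipyramid pass this test; its last clause
   excludes cliques of size 4. *)
Definition near_K5 (L : seq (seq (seq nat))) (m : nat) (r : rel nat) : bool :=
  let I := iota 0 m in
  if lhas (fun i => lhas (fun j =>
       if r i j then count (fun k => r i k && r j k) I <= 2 else false) I) I then
  if lall (fun i => lall (fun j => if r i j then true else if i == j then true else
       lhas (K5_bags (add_edge i j r)) L) I) I then
  lall (fun i => lall (fun j => if r i j then
    lall (fun k => if r i k && r j k then
      lall (fun l => ~~ [&& r i l, r j l & r k l]) I else true) I else true) I) I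
  else false else false.

Definition non_edge (F : seq (nat * nat)) : rel nat :=
  fun i j => lhas (fun p => if p.1 == i then p.2 == j
                            else if p.1 == j then p.2 == i else false) F.

Definition good_table (L : seq (seq (seq nat))) (m : nat) (M : seq (seq bool)) : bool :=
  if lhas (K5_bags (tadj M)) L then true else near_K5 L m (tadj M).

(** A vertex of degree at least 4 has at most [m - 1 - 4] non-neighbours. *)
Definition sparse_at (m : nat) (F : seq (nat * nat)) (i : nat) : bool :=
  count (non_edge F i) (iota 0 m) <= m - 5.

(* [F] collects the non-edges chosen so far and [ps] the pairs still undecided;
   branches in which a vertex has more than [m - 5] non-neighbours are pruned. *)
Fixpoint search (L : seq (seq (seq nat))) (m : nat) (ps F : seq (nat * nat)) : bool :=
  if ps is p :: ps' then
    if search L m ps' F then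
      if sparse_at m (p :: F) p.1 && sparse_at m (p :: F) p.2 then
        search L m ps' (p :: F)
      else true
    else false
  else good_table L m (tab m (fun i j => (i != j) && ~~ non_edge F i j)).

Definition pairs (m : nat) : seq (nat * nat) :=
  [seq (i, j) | i <- iota 0 m, j <- iota i.+1 (m - i.+1)].

(** The finite check behind the dichotomy. It runs over labelled graphs, not isomorphism classes;
    pruning leaves at most two non-edges at each vertex. *)
Lemma search567 :
  all (fun m => search (partitions5 m) m (pairs m) [::]) [:: 5; 6; 7].
Proof. by vm_compute. Qed.

Lemma mem_pairs m (i j : nat) : ((i, j) \in pairs m) = (i < j < m).
Proof.
apply/allpairsPdep/idP => [[i' [j' [_ + [ei ej]]]]|ijm].
  by rewrite -ei -ej mem_iota; lia.
by exists i, j; rewrite !mem_iota; split=> //; lia.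
Qed.

Lemma non_edgeE F i j : non_edge F i j = ((i, j) \in F) || ((j, i) \in F).
Proof.
rewrite /non_edge lhasE; elim: F => //= -[a b] F ->.
rewrite !inE !xpair_eqE /= orbACA (eq_sym i a) (eq_sym j b) (eq_sym j a) (eq_sym i b).
congr orb; case: eqVneq => [->|_] /=; last by case: (a == j).
by case: (eqVneq i j) => [->|_] /=; rewrite ?orbb ?orbF.
Qed.

Lemma sparse_at_sub m F F' i : {subset F <= F'} -> sparse_at m F' i -> sparse_at m F i.
Proof.
move=> FF'; apply: leq_trans; apply: sub_count => j.
by rewrite !non_edgeE => /orP[] /FF' ->; rewrite ?orbT.
Qed.

(** The predicate [q] names one branch of the search, and [catrev] is the list that this branch
    accumulates. Pruning never cuts it, since a sublist of a sparse list of non-edges is sparse. *)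
Lemma search_sound L m ps F (q : pred (nat * nat)) :
    let F' := catrev (filter q ps) F in
    (forall i, sparse_at m F' i) -> search L m ps F ->
  good_table L m (tab m (fun i j => (i != j) && ~~ non_edge F' i j)).
Proof.
elim: ps F => //= p ps IH F sF; case: ifP => // sps sp.
case: (q p) sF => /= sF; last exact: IH.
move: sp; rewrite ifT; first exact: IH.
by apply/andP; split; apply: sparse_at_sub (sF _) => x xF;
  rewrite catrevE mem_cat xF orbT.
Qed.

Lemma link_table m (r : rel nat) :
    symmetric r -> irreflexive r -> 4 < m < 8 ->
    (forall i, i < m -> 4 <= count (r i) (iota 0 m)) ->
  good_table (partitions5 m) m (tab m r).
Proof.
(* The branch to follow selects the non-adjacent pairs, so its leaf is the given graph. *)
move=> sr ir m58 dr; set q := fun p : nat * nat => ~~ r p.1 p.2.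
have Fq i j : non_edge (catrev (filter q (pairs m)) [::]) i j =
    [&& i < m, j < m, i != j & ~~ r i j].
  rewrite non_edgeE catrevE cats0 !mem_rev !mem_filter !mem_pairs /q /= (sr j i).
  by case: (r i j); rewrite /=; lia.
have -> : tab m r = tab m (fun i j => (i != j) &&
    ~~ non_edge (catrev (filter q (pairs m)) [::]) i j).
  apply: eq_tab => i j im jm; rewrite Fq im jm /=.
  by case: eqVneq => [->|] /=; rewrite ?ir ?negbK.
apply: search_sound => [i|]; last first.
  have: m \in [:: 5; 6; 7] by rewrite !inE; lia.
  by move/(allP search567).
rewrite /sparse_at; case: (ltnP i m) => im; last first.
  rewrite (@eq_count _ _ pred0) ?count_pred0 // => j.
  by rewrite Fq ltnNge im.
(* The vertices split into [i], its neighbours (at least 4) and the others, which leaves at most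
   [m - 5] others. *)
pose A : pred nat := pred1 i.
have cC := count_predC (predU A (r i)) (iota 0 m).
have cUI := count_predUI A (r i) (iota 0 m).
have cI : count (predI A (r i)) (iota 0 m) = 0.
  rewrite (@eq_count _ _ pred0) ?count_pred0 // => j.
  by rewrite /A /=; case: eqVneq => [->|] //=; rewrite ir.
have c1 : count A (iota 0 m) = 1.
  by rewrite count_uniq_mem ?iota_uniq // mem_iota im.
have dri := dr i im.
have le : count (non_edge (catrev (filter q (pairs m)) [::]) i) (iota 0 m) <=
    count (predC (predU A (r i))) (iota 0 m).
  by apply: sub_count => j; rewrite Fq /A /= eq_sym negb_or => /and4P[_ _ -> ->].
rewrite size_iota in cC.
by lia.
Qed.

(** * Minor models: lifting through branch sets and coning over a vertex *)

Definition touch (T : finType) (e : rel T) (A B : {set T}) : Prop :=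
  exists x y, [/\ x \in A, y \in B & e x y].

Lemma touch_sym (T : finType) (e : rel T) A B :
  symmetric e -> touch e A B -> touch e B A.
Proof. by move=> se [x [y [xA yB exy]]]; exists y, x; rewrite se. Qed.

Lemma touchS (T : finType) (e : rel T) (A B A' B' : {set T}) :
  A \subset A' -> B \subset B' -> touch e A B -> touch e A' B'.
Proof.
move=> /subsetP sA /subsetP sB [x [y [xA yB exy]]].
by exists x, y; split; [apply: sA | apply: sB |].
Qed.

(** The ambient set [V] lets induction delete and contract without changing the vertex type. *)
Definition model (T : finType) (e : rel T) (V : {set T}) n (B : 'I_n -> {set T}) : Prop :=
  [/\ forall i, (B i \subset V) && (B i != set0),
      forall i, connected_in e (B i),
      forall i j, i != j -> [disjoint B i & B j] &
      forall i j, i != j -> touch e (B i) (B j)].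

Lemma connected_in1 (T : finType) (e : rel T) x : connected_in e [set x].
Proof. by move=> y z /set1P-> /set1P->. Qed.

Lemma connected_sub (T : finType) (e : rel T) (A A' : {set T}) x y :
    A \subset A' ->
    connect [rel u v | [&& e u v, u \in A & v \in A]] x y ->
  connect [rel u v | [&& e u v, u \in A' & v \in A']] x y.
Proof.
move=> /subsetP sA; apply: connect_sub => u w /= /and3P[euw uA wA].
by apply: connect1; rewrite /= euw !sA.
Qed.

(** Follow a path of [e'] in [B]: inside each [D i] walk to an endpoint of an edge leading into the
    next set. *)
Lemma connected_bigcup (I T : finType) (e' : rel I) (e : rel T)
    (D : I -> {set T}) (B : {set I}) :
    connected_in e' B -> (forall i, i \in B -> connected_in e (D i)) ->
    (forall i j, i \in B -> j \in B -> e' i j -> touch e (D i) (D j)) ->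
  connected_in e (\bigcup_(i in B) D i).
Proof.
move=> cB cD tD x y /bigcupP[i iB xi] /bigcupP[j jB yj].
have /connectP[p pth jE] := cB i j iB jB.
elim: p => [|k p IH] /= in i iB x xi pth jE *.
  by rewrite jE in yj; apply: connected_sub (cD i iB x y xi yj); apply: bigcup_sup.
case/andP: pth => /and3P[eik _ kB] pth.
have [a [b [ai bk eab]]] := tD i k iB kB eik.
apply: connect_trans (IH k kB b bk pth jE).
apply: (@connect_trans _ _ a).
  by apply: connected_sub (cD i iB x a xi ai); apply: bigcup_sup.
apply: connect1; rewrite /= eab /=; apply/andP.
by split; apply/bigcupP; [exists i | exists k].
Qed.

(** Minors compose: each vertex [i] of the small graph is expanded into the branch set [D i]. *)
Lemma lift_model (I T : finType) (e' : rel I) (e : rel T) (U : {set I})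
    (V : {set T}) (D : I -> {set T}) n (B : 'I_n -> {set I}) :
    (forall i, i \in U -> (D i \subset V) && (D i != set0)) ->
    (forall i, i \in U -> connected_in e (D i)) ->
    (forall i j, i \in U -> j \in U -> i != j -> [disjoint D i & D j]) ->
    (forall i j, i \in U -> j \in U -> e' i j -> touch e (D i) (D j)) ->
    model e' U B ->
  model e V (fun k => \bigcup_(i in B k) D i).
Proof.
move=> DV cD dD tD [BU cB dB tB].
have inU k i : i \in B k -> i \in U.
  by have /andP[/subsetP BkU _] := BU k; apply: BkU.
split=> [k|k|k l kl|k l kl].
- have /andP[_ /set0Pn[i iB]] := BU k.
  have /andP[_ /set0Pn[x xD]] := DV i (inU k i iB).
  apply/andP; split; last by apply/set0Pn; exists x; apply/bigcupP; exists i.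
  by apply/bigcupsP => j /inU /DV /andP[].
- apply: connected_bigcup (cB k) _ _ => [i /inU|i j /inU iU /inU]; first exact: cD.
  exact: tD.
- rewrite -setI_eq0; apply/eqP/setP => x; rewrite !inE.
  apply/negP => /andP[/bigcupP[i iB xi] /bigcupP[j jB xj]].
  have ij : i != j.
    by apply: contraTneq jB => <-; rewrite (disjointFr (dB k l kl) iB).
  by have := disjointFr (dD i j (inU _ _ iB) (inU _ _ jB) ij) xi; rewrite xj.
- have [i [j [iB jB eij]]] := tB k l kl.
  by apply: touchS (tD i j (inU _ _ iB) (inU _ _ jB) eij); apply: bigcup_sup.
Qed.

(** This turns a [K_5] model in a link into a [K_6] model: index [ord0] goes to [v], and [unlift]
    renumbers the others. *)
Lemma cone_model (T : finType) (e : rel T) (V : {set T}) n (B : 'I_n -> {set T}) v :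
    symmetric e -> v \in V -> (forall i, v \notin B i) ->
    (forall i, touch e [set v] (B i)) -> model e V B ->
  model e V (fun k => if unlift ord0 k is Some i then B i else [set v]).
Proof.
move=> se vV vB tv [BV cB dB tB]; split=> [k|k|k l|k l].
- case: unliftP => // _; rewrite sub1set vV; apply/set0Pn; exists v; exact: set11.
- by case: unliftP => // _; apply: connected_in1.
- case: unliftP => [i|] ->; case: unliftP => [j|] -> //.
  + by move=> ij; apply: dB; apply: contraNneq ij => ->.
  + by move=> _; rewrite disjoint_sym disjoints1.
  + by move=> _; rewrite disjoints1.
- case: unliftP => [i|] ->; case: unliftP => [j|] -> //.
  + by move=> ij; apply: tB; apply: contraNneq ij => ->.
  + by move=> _; apply: touch_sym.
Qed.

(** Only three values of [m] occur, so computation replaces an induction over [partitions]. *)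
Lemma partitions5_disjoint :
  all (fun m => all (fun P => [&& size P == 5, all (all (gtn m)) P &
         pairwise (fun A B : seq nat => ~~ has (mem A) B) P]) (partitions5 m)) [:: 5; 6; 7].
Proof. by vm_compute. Qed.

Lemma pairwise_sym (A : eqType) (r : rel A) s x y :
  symmetric r -> pairwise r s -> x \in s -> y \in s -> x != y -> r x y.
Proof.
move=> sr; elim: s => //= z s IH /andP[/allP rz rs]; rewrite !inE.
case: (eqVneq x z) => [-> _|_ /= xs].
  by case: (eqVneq y z) => [->|_ /= ys _] //; apply: rz.
case: (eqVneq y z) => [-> _ _|_ /= ys]; first by rewrite sr; apply: rz.
exact: IH.
Qed.

Lemma K5_bags_model m (r : rel nat) P :
    symmetric r -> 4 < m < 8 -> P \in partitions5 m -> K5_bags r P ->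
  model [rel i j : 'I_m | r i j] setT
    (fun k : 'I_5 => [set i : 'I_m | val i \in nth [::] P k]).
Proof.
move=> sr m58 Pm; rewrite /K5_bags lallE; case: ifP => // cP; rewrite lpairwiseE => tP.
have: m \in [:: 5; 6; 7] by rewrite !inE; lia.
move=> /(allP partitions5_disjoint) /allP /(_ P Pm) /and3P[/eqP sP ltP dP].
have inP k : k < 5 -> nth [::] P k \in P by move=> k5; apply: mem_nth; rewrite sP.
have touchP (k l : 'I_5) : k != l -> exists i j : 'I_m,
    [/\ val i \in nth [::] P k, val j \in nth [::] P l & r i j].
  wlog kl : k l / k < l => [H kl | _].
    case: (ltngtP k l) => [kl'|lk|/val_inj kl']; first exact: H.
      have [|i [j [ik jl rij]]] := H l k lk; first by rewrite eq_sym.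
      by exists j, i; rewrite sr.
    by rewrite kl' eqxx in kl.
  have := (pairwiseP [::] tP) k l; rewrite !inE sP => /(_ (ltn_ord k) (ltn_ord l) kl).
  rewrite lhasE => /hasP[i ik]; rewrite lhasE => /hasP[j jl rij].
  have im := allP (allP ltP _ (inP k (ltn_ord k))) i ik.
  have jm := allP (allP ltP _ (inP l (ltn_ord l))) j jl.
  by exists (Ordinal im), (Ordinal jm).
split=> [k|k|k l|k l kl].
(* A bag is nonempty because it touches some other bag. *)
- have [l kl] : exists l : 'I_5, k != l.
    by case: (eqVneq k ord0) => [->|]; [exists ord_max | exists ord0].
  have [i [_ [ik _ _]]] := touchP k l kl.
  by rewrite subsetT; apply/set0Pn; exists i; rewrite inE.
- move=> i j; rewrite !inE => ik jk; case: (eqVneq i j) => [->//|ij].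
  apply: connect1; rewrite /= !inE ik jk !andbT.
  have := allP cP _ (inP k (ltn_ord k)); rewrite lpairwiseE => /pairwise_sym; exact.
- wlog kl : k l / k < l => [H kl | _].
    case: (ltngtP k l) => [kl'|lk|/val_inj kl']; first exact: H.
      by rewrite disjoint_sym; apply: H; rewrite // eq_sym.
    by rewrite kl' eqxx in kl.
  have := (pairwiseP [::] dP) k l; rewrite !inE sP => /(_ (ltn_ord k) (ltn_ord l) kl) nh.
  rewrite -setI_eq0; apply/eqP/setP => i; rewrite !inE.
  by apply: contraNF nh => /andP[ik il]; apply/hasP; exists (val i).
- by have [i [j [ik jl rij]]] := touchP k l kl; exists i, j; rewrite !inE.
Qed.

(** * The dichotomy at a vertex of small degree: a [K_6] minor or a clique separator *)

Definition nbh (T : finType) (e : rel T) (V : {set T}) (x : T) : {set T} :=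
  [set y in V | e x y].

(** For irreflexive [e], the vertex [v] lies outside both [C] and [S], so [S] cuts [C] off from [v].
    The size bound serves the edge count across the separator. *)
Definition clique_separator (T : finType) (e : rel T) (V : {set T}) (v : T)
    (C S : {set T}) : Prop :=
  [/\ C \subset V :\: (v |: nbh e V v), C != set0, S \subset nbh e V v,
      forall x y, x \in C -> y \in V -> e x y -> y \in C :|: S &
      {in S &, forall x y, x != y -> e x y} /\ #|S| <= 3].

Lemma count_nth_enum (T : finType) (A : {set T}) x0 (p : pred T) :
  count (fun j => p (nth x0 (enum A) j)) (iota 0 #|A|) = #|[set u in A | p u]|.
Proof.
rewrite -(count_map (nth x0 (enum A)) p) cardE -/(mkseq _ _) mkseq_nth -size_filter cardE.
apply/perm_size/uniq_perm => [||u]; [exact/filter_uniq/enum_uniq|exact: enum_uniq|].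
by rewrite mem_filter !mem_enum inE andbC.
Qed.

Lemma connected_component (T : finType) (r e : rel T) w :
    symmetric r -> subrel r e -> connected_in e [set z | connect r w z].
Proof.
move=> sr re; set C := [set z | _].
have sC : connect_sym [rel u z | [&& r u z, u \in C & z \in C]].
  by apply: sym_connect_sym => u z; rewrite /= sr [(u \in _) && _]andbC.
have H z : z \in C -> connect [rel u z | [&& r u z, u \in C & z \in C]] w z.
  rewrite inE => /connectP[p + ->]; elim/last_ind: p => [|p x IH] //.
  rewrite rcons_path last_rcons => /andP[pth rx]; apply: connect_trans (IH pth) _.
  apply: connect1; rewrite /= rx !inE /=; apply/andP; split.
    by apply/connectP; exists p.
  by apply/connectP; exists (rcons p x); rewrite ?rcons_path ?pth ?last_rcons.
move=> x y xC yC; have := connect_trans _ (H y yC) => /(_ x).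
rewrite sC => /(_ (H x xC)); apply: connect_sub => u z /= /and3P[ruz uC zC].
by apply: connect1; rewrite /= re ?uC.
Qed.

Section Link.
Variables (T : finType) (e : rel T) (V : {set T}) (v : T).
Hypotheses (se : symmetric e) (ire : irreflexive e) (vV : v \in V).

Let N := nbh e V v.
Let t (i : nat) : T := nth v (enum N) i.
Let m := #|N|.
Hypothesis m58 : 4 < m < 8.

Let tN i : i < m -> t i \in N.
Proof. by move=> im; rewrite -mem_enum mem_nth -?cardE. Qed.

Let t_inj i j : i < m -> j < m -> t i = t j -> i = j.
Proof.
move=> im jm /eqP; rewrite nth_uniq ?enum_uniq -?cardE //; exact: eqP.
Qed.

Let v_tN i : i < m -> e v (t i).
Proof. by move=> /tN; rewrite inE => /andP[]. Qed.

Let t_neq_v i : i < m -> t i != v.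
Proof. by move=> /v_tN; apply: contraTneq => ->; rewrite ire. Qed.

(* The link model is lifted along [t], with the connected set [C] attached to
   the vertex [a], which realizes the extra edge of the link. *)
Lemma link_model (r' : rel nat) (C : {set T}) (a : nat) P :
    symmetric r' -> P \in partitions5 m -> K5_bags r' P ->
    C \subset V :\: (v |: N) -> connected_in e C ->
    (C != set0 -> touch e [set t a] C) ->
    (forall i j, i < m -> j < m -> r' i j ->
       [\/ e (t i) (t j), i = a /\ touch e C [set t j] | j = a /\ touch e C [set t i]]) ->
  exists B : 'I_6 -> {set T}, model e V B.
Proof.
move=> sr' Pm K5P CV cC aC tr'.
pose D (i : 'I_m) := t i |: (if i == a :> nat then C else set0).
have mB := K5_bags_model sr' m58 Pm K5P.
have tD (i : 'I_m) : t i \in D i by rewrite !inE eqxx.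
have CP x : x \in C -> [/\ x \in V, x != v & x \notin N].
  by move=> /(subsetP CV); rewrite !inE negb_or => /andP[/andP[-> ->] ->].
have DP (i : 'I_m) x : x \in D i -> x = t i \/ (i = a :> nat /\ x \in C).
  by rewrite !inE => /orP[/eqP|]; [left | case: eqP => [|_]; rewrite ?inE //; right].
have DV (i : 'I_m) : D i \subset V.
  apply/subsetP => x /DP[->|[_ /CP[] //]].
  by have := tN (ltn_ord i); rewrite inE => /andP[].
have cD (i : 'I_m) : connected_in e (D i).
  rewrite /D; case: eqP => [ia|_]; last by rewrite setU0; apply: connected_in1.
  have [C0|Cn0] := eqVneq C set0; first by rewrite C0 setU0; apply: connected_in1.
  (* The bag is a union indexed by a two-vertex graph on [bool], so [connected_bigcup] applies. *)
  pose E (b : bool) := if b then C else [set t a].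
  have -> : t i |: C = \bigcup_(b in [set: bool]) E b.
    rewrite ia; apply/setP => x; rewrite inE; apply/orP/bigcupP => [[xa|xC]|[[] _ xE]].
    - by exists false; [apply: in_setT | exact: xa].
    - by exists true; [apply: in_setT | exact: xC].
    - by right.
    - by left.
  apply: (@connected_bigcup _ _ (fun b b' => b != b')) => [b b' _ _|[] _|].
  - by case: (eqVneq b b') => [->//|bb']; apply: connect1; rewrite /= bb' !inE.
  - exact: cC.
  - exact: connected_in1.
  - by move=> [] [] // _ _ _; [apply: touch_sym => //|]; apply: aC.
have dD (i j : 'I_m) : i != j -> [disjoint D i & D j].
  move=> ij; rewrite -setI_eq0; apply/eqP/setP => x; rewrite [RHS]inE inE.
  apply/negP => /andP[/DP xi /DP xj]; case: xi xj => [->|[ia xC]] [|[ja +]].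
  - by move/(t_inj (ltn_ord i) (ltn_ord j))/val_inj/eqP; rewrite (negPf ij).
  - by move=> /CP[_ _]; rewrite tN.
  - by move=> xt; have [_ _] := CP x xC; rewrite xt tN.
  - by move=> _; case/eqP: ij; apply: val_inj; rewrite /= ia ja.
have tDD (i j : 'I_m) : r' i j -> touch e (D i) (D j).
  have CD (k : 'I_m) : k = a :> nat -> C \subset D k.
    by move=> ka; rewrite /D ka eqxx subsetUr.
  case/(tr' i j (ltn_ord i) (ltn_ord j)) => [eij|[ia tC]|[ja tC]].
  - by exists (t i), (t j); split.
  - by apply: touchS tC; rewrite ?CD // sub1set.
  - by apply: touch_sym => //; apply: touchS tC; rewrite ?CD // sub1set.
have DV' (i : 'I_m) : (D i \subset V) && (D i != set0).
  by rewrite DV; apply/set0Pn; exists (t i).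
have mD := lift_model (fun i _ => DV' i) (fun i _ => cD i)
  (fun i j _ _ => @dD i j) (fun i j _ _ => @tDD i j) mB.
eexists; apply: cone_model se vV _ _ mD.
- move=> k; apply/negP => /bigcupP[i _ /DP[vt|[_ /CP[_]]]]; last by rewrite eqxx.
  by have := t_neq_v (ltn_ord i); rewrite -vt eqxx.
- move=> k; case: mB => [/(_ k)/andP[_ /set0Pn[i iB]] _ _ _].
  exists v, (t i); rewrite set11 v_tN //; split=> //.
  by apply/bigcupP; exists i.
Qed.

End Link.

Lemma K6_or_clique_separator (T : finType) (e : rel T) (V : {set T}) v :
    symmetric e -> irreflexive e -> v \in V -> 0 < #|nbh e V v| < 8 ->
    (forall x y, x \in V -> y \in V -> e x y ->
       4 <= #|nbh e V x :&: nbh e V y|) ->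
  (exists B : 'I_6 -> {set T}, model e V B) \/
  (exists C S, clique_separator e V v C S).
Proof.
move=> se ire vV m08 triV; set N := nbh e V v in m08 *; set m := #|N| in m08.
pose t i := nth v (enum N) i; pose rt : rel nat := fun i j => e (t i) (t j).
have NP x : (x \in N) = (x \in V) && e v x by rewrite inE.
have degN u : u \in N -> 4 <= #|[set w in N | e u w]|.
  rewrite NP => /andP[uV evu]; apply: leq_trans (triV v u vV uV evu) _.
  by apply/subset_leq_card/subsetP => w; rewrite !inE => /andP[-> /andP[_ ->]].
(* A link vertex and its four or more neighbours in the link give at least 5 vertices. *)
have m58 : 4 < m < 8.
  case/andP: m08 => /card_gt0P[u uN] ->; rewrite andbT.
  apply: leq_ltn_trans (degN u uN) (proper_card _); apply/properP.
  by split; [apply/subsetP => w /setIdP[] | exists u; rewrite // inE ire andbF].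
have tN i : i < m -> t i \in N by move=> im; rewrite -mem_enum mem_nth -?cardE.
have t_index x : x \in N -> exists2 i, i \in iota 0 m & t i = x.
  move=> xN; exists (index x (enum N)); last by rewrite /t nth_index ?mem_enum.
  by rewrite mem_iota /m cardE index_mem mem_enum.
have rtE i j : i \in iota 0 m -> j \in iota 0 m -> tadj (tab m rt) i j = e (t i) (t j).
  by rewrite !mem_iota tadj_tab => /andP[_ ->] /andP[_ ->].
have rtS : symmetric (tadj (tab m rt)).
  by move=> i j; rewrite !tadj_tab /rt se andbCA.
have: good_table (partitions5 m) m (tab m rt).
  apply: link_table => // [i j|i|i im]; [exact: se | exact: ire |].
  by rewrite /rt count_nth_enum; apply/degN/tN.
rewrite /good_table lhasE; case: ifP => [/hasP[P Pm KP] _|_].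
  (* The link itself has the model, so nothing is attached: [C] is empty and the index [0] is a
     dummy. *)
  left; apply: (@link_model _ _ _ v se ire vV m58 _ set0 0 P rtS Pm KP).
  - exact: sub0set.
  - by move=> x; rewrite inE.
  - by rewrite eqxx.
  - by move=> i j im jm; rewrite tadj_tab => /and3P[_ _ eij]; apply: Or31.
rewrite /near_K5 lhasE; case: ifP => // /hasP[i im]; rewrite lhasE => /hasP[j jm].
case: ifP => // rij cij; case: ifP => //; rewrite lallE => /allP addK.
rewrite lallE => /allP noK4.
have eij : e (t i) (t j) by rewrite -rtE.
have [tiV tjV] : t i \in V /\ t j \in V.
  move: (im) (jm); rewrite !mem_iota => /andP[_ /tN] + /andP[_ /tN].
  by rewrite !NP => /andP[-> _] /andP[-> _].
(* The chosen link edge has at most two common neighbours in the link, and [v] makes three; a fourth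
   must lie outside the closed neighbourhood of [v]. *)
have [w wij wN] : exists2 w, w \in nbh e V (t i) :&: nbh e V (t j) & w \notin v |: N.
  apply/subsetPn/negP => sN; have := triV _ _ tiV tjV eij; apply/negP; rewrite -ltnNge.
  rewrite (@leq_ltn_trans #|v |: [set u in N | e (t i) u && e (t j) u]|) //.
    apply/subset_leq_card/subsetP => u uij; move/subsetP/(_ u uij): sN.
    by move: uij; rewrite !inE => /andP[/andP[-> ->] /andP[_ ->]]; rewrite !andbT.
  rewrite (leq_ltn_trans (leq_card_setU _ _)) // cards1 add1n !ltnS.
  apply: leq_trans cij; rewrite -(count_nth_enum _ v).
  rewrite (@eq_in_count _ _ (fun k => tadj (tab m rt) i k && tadj (tab m rt) j k)) //.
  by move=> k km; rewrite /= !rtE.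
pose W := V :\: (v |: N).
have wW : w \in W by rewrite inE wN; move: wij; rewrite !inE => /andP[/andP[-> _] _].
pose q : rel T := [rel x y | [&& e x y, x \in W & y \in W]].
have qS : symmetric q by move=> x y; rewrite /q /= se [(x \in _) && _]andbC.
pose C := [set z | connect q w z].
have CW : C \subset W.
  apply/subsetP => z; rewrite inE => /connectP[p + ->]; case/lastP: p => // p x.
  by rewrite rcons_path last_rcons => /andP[_ /and3P[]].
have cC : connected_in e C by apply: connected_component => // x y /and3P[].
pose S := [set u in N | [exists x in C, e x u]].
have SN : S \subset N by apply/subsetP => u /setIdP[].
have tSC u : u \in S -> touch e [set u] C.
  by rewrite inE => /andP[_ /'exists_andP[x [xC exu]]]; exists u, x; rewrite set11 se.
case: (boolP [exists a in S, exists b in S, (a != b) && ~~ e a b]).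
  case/'exists_andP => a [aS /'exists_andP[b [bS /andP[ab neab]]]].
  have [i0 i0m ia] := t_index a (subsetP SN a aS).
  have [j0 j0m jb] := t_index b (subsetP SN b bS).
  have := addK i0 i0m; rewrite lallE => /allP/(_ j0 j0m).
  rewrite rtE // ia jb (negPf neab); case: eqP => [ij|_].
    by rewrite -ia -jb ij eqxx in ab.
  rewrite lhasE => /hasP[P Pm KP]; left.
  (* Merging [C] into [a = t i0] realizes the added edge from [i0] to [j0]. *)
  apply: (@link_model _ _ _ v se ire vV m58 _ C i0 P _ Pm KP) => //.
  - by move=> k l; rewrite /add_edge rtS orbC [RHS]orbC; congr orb; rewrite orbC andbC [X in _ || X]andbC.
  - by move=> _; rewrite -/N -/(t i0) ia; apply: tSC.
  - move=> k l km lm; rewrite /add_edge -/N -/(t k) -/(t l) tadj_tab => /or3P[].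
    + by case/and3P=> _ _; apply: Or31.
    + by case/andP=> /eqP-> /eqP->; apply: Or32; rewrite jb; split=> //; apply/touch_sym/tSC.
    + by case/andP=> /eqP-> /eqP->; apply: Or33; rewrite jb; split=> //; apply/touch_sym/tSC.
move=> cliqueS; right; exists C, S.
have clS : {in S &, forall x y, x != y -> e x y}.
  move=> a b aS bS ab; apply: contraNT cliqueS => neab.
  by apply/'exists_andP; exists a; split=> //; apply/'exists_andP; exists b; rewrite ab.
split=> //; first by apply/set0Pn; exists w; rewrite inE connect0.
  move=> x y xC yV exy; apply/setUP; case: (boolP (y \in N)) => yN; [right|left].
    by apply/setIdP; split=> //; apply/'exists_andP; exists x.
  have xW := subsetP CW x xC.
  have yW : y \in W.
    rewrite in_setD yV andbT in_setU1 negb_or yN andbT; apply: contraTneq exy => ->.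
    by move: xW; rewrite in_setD in_setU1 NP negb_or se => /andP[/andP[_ /nandP[/negPf->|]]] //.
  move: xC; rewrite !inE => /connect_trans; apply.
  by apply: connect1; rewrite /q /= exy xW.
(* Four vertices of [S] would form a [K_4] in the link, against the last clause of [near_K5]. *)
split=> //; rewrite leqNgt; apply/negP => /card_geqP[s [us ss sS]].
case: s us ss sS => [|a [|b [|c [|d []]]]] //=.
rewrite !inE !negb_or => /and4P[/and3P[ab ac ad] /andP[bc bd] cd _] _ sS.
have [[aS bS] [cS dS]] : (a \in S /\ b \in S) /\ (c \in S /\ d \in S).
  by split; split; apply: sS; rewrite !inE eqxx ?orbT.
have [ia iam ta] := t_index a (subsetP SN a aS).
have [ib ibm tb] := t_index b (subsetP SN b bS).
have [ic icm tc] := t_index c (subsetP SN c cS).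
have [id idm td] := t_index d (subsetP SN d dS).
have := noK4 ia iam; rewrite lallE => /allP/(_ ib ibm).
rewrite rtE // ta tb clS // lallE => /allP/(_ ic icm).
rewrite !rtE // ta tb tc !clS //= lallE => /allP/(_ id idm).
by rewrite !rtE // ta tb tc td !clS.
Qed.

(** * Edge counts under deletion, contraction and separation, and the extremal bound *)

Definition edges (T : finType) (e : rel T) (V : {set T}) : {set T * T} :=
  [set p | [&& p.1 \in V, p.2 \in V & e p.1 p.2]].

Lemma card_edges (T : finType) (e : rel T) (V : {set T}) :
  #|edges e V| = \sum_(x in V) #|nbh e V x|.
Proof.
rewrite -sum1_card; under [RHS]eq_bigr => x _ do rewrite -sum1_card.
by rewrite pair_big_dep /=; apply: eq_bigl => -[x y]; rewrite !inE.
Qed.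

Lemma nbhD1 (T : finType) (e : rel T) (V : {set T}) x : irreflexive e -> nbh e V x \subset V :\ x.
Proof.
by move=> ire; apply/subsetP => y; rewrite !inE => /andP[-> exy]; rewrite andbT;
  apply: contraTneq exy => ->; rewrite ire.
Qed.

Lemma card_edges_clique (T : finType) (e : rel T) (S : {set T}) :
    irreflexive e -> {in S &, forall x y, x != y -> e x y} ->
  #|edges e S| = #|S| * #|S|.-1.
Proof.
move=> ire cS; rewrite card_edges -sum_nat_const; apply: eq_bigr => x xS.
rewrite (cardsD1 x S) xS; apply: eq_card => y; rewrite !inE andbC.
case: (boolP (y \in S)) => yS; rewrite ?andbF // !andbT.
case: eqVneq => [->|yx]; first by rewrite ire.
by rewrite cS // eq_sym.
Qed.

Lemma edges_del (T : finType) (e : rel T) (V : {set T}) y :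
  symmetric e -> #|edges e V| <= #|edges e (V :\ y)| + #|nbh e V y|.*2.
Proof.
move=> se; set N := nbh e V y.
have sE : edges e V \subset edges e (V :\ y) :|: (setX [set y] N :|: setX N [set y]).
  apply/subsetP => -[a b]; rewrite !inE /= => /and3P[aV bV eab]; rewrite aV bV eab.
  case: (eqVneq a y) => [<-|_] /=; first by rewrite eab.
  by case: (eqVneq b y) => [<-|_] //=; rewrite se eab.
apply: leq_trans (subset_leq_card sE) _; apply: leq_trans (leq_card_setU _ _) _.
rewrite leq_add2l; apply: leq_trans (leq_card_setU _ _) _.
by rewrite !cardsX cards1 mul1n muln1 addnn.
Qed.

Lemma sub_model (T : finType) (e e' : rel T) (V V' : {set T}) n (B : 'I_n -> {set T}) :
  V' \subset V -> subrel e' e -> model e' V' B -> model e V B.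
Proof.
move=> sV sub_e [BV cB dB tB]; split=> // [i|i x y xB yB|i j ij].
- by have /andP[BV' ->] := BV i; rewrite (subset_trans BV' sV).
- apply: connect_sub (cB i x y xB yB) => u w /= /and3P[euw uB wB].
  by apply: connect1; rewrite /= sub_e ?uB.
- by have [x [y [xB yB exy]]] := tB i j ij; exists x, y; rewrite sub_e.
Qed.

(** The vertex [x] inherits the neighbours of [y], without a loop; [y] disappears only when [V] is
    replaced by [V :\ y]. *)
Definition contract (T : finType) (e : rel T) (x y : T) : rel T :=
  [rel u w | [|| e u w, [&& u == x, w != x & e y w] | [&& w == x, u != x & e y u]]].

Lemma contract_model (T : finType) (e : rel T) (V : {set T}) x y n (B : 'I_n -> {set T}) :
    symmetric e -> x \in V -> y \in V -> e x y -> x != y ->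
    model (contract e x y) (V :\ y) B ->
  exists B' : 'I_n -> {set T}, model e V B'.
Proof.
move=> se xV yV exy xy mB.
pose D u := if u == x then [set x; y] else [set u].
have uD u : u \in D u by rewrite /D; case: eqP => [->|_]; rewrite !inE eqxx.
have yD : y \in D x by rewrite /D eqxx !inE eqxx orbT.
eexists; apply: (lift_model (D := D) _ _ _ _ mB) => [u|u _|u w|u w].
- rewrite !inE => /andP[_ uV]; apply/andP; split; last by apply/set0Pn; exists u.
  by rewrite /D; case: eqP => _; rewrite ?subUset !sub1set ?xV.
- rewrite /D; case: eqP => _; last exact: connected_in1.
  move=> a b; rewrite !inE => /orP[] /eqP-> /orP[] /eqP-> //.
    by apply: connect1; rewrite /= exy !inE !eqxx orbT.
  by apply: connect1; rewrite /= se exy !inE !eqxx orbT.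
- rewrite !inE => /andP[uy _] /andP[wy _] uw; rewrite /D.
  case: eqP => [ux|_]; last first.
    rewrite disjoints1; case: eqP => [wx|_]; last by rewrite inE.
    by rewrite !inE -wx negb_or uw uy.
  rewrite eq_sym -ux eq_sym (negPf (_ : w != u)) 1?eq_sym // disjoint_sym disjoints1.
  by rewrite !inE negb_or eq_sym uw.
- move=> _ _ /= /or3P[euw|/and3P[/eqP-> _ eyw]|/and3P[/eqP-> _ eyu]].
  + by exists u, w; split.
  + by exists y, w; split.
  + by exists u, y; split=> //; rewrite se.
Qed.

(** Contraction loses the edge [xy] and one edge for each common neighbour, each counted in both
    directions. *)
Lemma contract_edges (T : finType) (e : rel T) (V : {set T}) x y :
    symmetric e -> irreflexive e -> x \in V -> y \in V -> e x y ->
  #|edges e V| <=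
    #|edges (contract e x y) (V :\ y)| + (#|nbh e V x :&: nbh e V y|.+1).*2.
Proof.
move=> se ire xV yV exy; have xy : x != y by apply: contraTneq exy => ->; rewrite ire.
apply: leq_trans (edges_del _ y se) _.
(* The private neighbours of [y]: their edges to [y] survive as new edges at [x]. *)
set W := nbh e V y :\: (x |: nbh e V x).
have -> : #|nbh e V y| = #|W| + #|nbh e V x :&: nbh e V y|.+1.
  rewrite -(cardsID (x |: nbh e V x)) addnC; congr (_ + _).
  rewrite setIC setIUl (setIidPl _) ?cardsU1 ?inE ?ire ?andbF ?add1n //.
  by rewrite sub1set inE xV se.
rewrite doubleD addnA leq_add2r.
have dis : [disjoint setX [set x] W & setX W [set x]].
  rewrite -setI_eq0; apply/eqP/setP => -[a b]; rewrite !inE /=.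
  by case: eqVneq => [->|]; rewrite ?andbF.
have dis' : [disjoint edges e (V :\ y) & setX [set x] W :|: setX W [set x]].
  rewrite -setI_eq0; apply/eqP/setP => -[a b]; rewrite !inE /=.
  apply/negP => /andP[/and3P[/andP[_ aV] /andP[_ bV] eab]].
  case/orP=> [/andP[/eqP ax]|/andP[+ /eqP bx]].
    by rewrite -ax eab bV orbT.
  by rewrite -bx se eab aV orbT.
rewrite -addnn -{1}[#|W|]mul1n -{2}[#|W|]muln1 -(cards1 x) -!cardsX.
rewrite -cardsUI (eqP (_ : _ :&: _ == set0)) ?setI_eq0 // cards0 addn0.
rewrite -cardsUI (eqP (_ : _ :&: _ == set0)) ?setI_eq0 // cards0 addn0.
apply/subset_leq_card/subsetP => -[a b]; rewrite /contract !inE /=.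
case/or3P=> [/and3P[-> -> ->] //|/andP[/eqP-> /andP[nx /andP[bV eyb]]]|].
  move: nx; rewrite negb_or xV xy bV eqxx eyb => /andP[-> _] /=; rewrite orbT !andbT.
  by apply: contraTneq eyb => ->; rewrite ire.
case/andP=> /andP[nx /andP[aV eya]] /eqP->.
move: nx; rewrite negb_or xV xy aV eqxx eya => /andP[-> _] /=; rewrite !orbT !andbT.
by apply: contraTneq eya => ->; rewrite ire.
Qed.

(** Inclusion-exclusion: every edge lies on one of the two sides, and edges inside [S] lie on
    both. *)
Lemma edges_separation (T : finType) (e : rel T) (V C S : {set T}) :
    symmetric e -> C \subset V -> S \subset V -> [disjoint C & S] ->
    (forall x y, x \in C -> y \in V -> e x y -> y \in C :|: S) ->
  #|edges e V| + #|edges e S| <= #|edges e (C :|: S)| + #|edges e (V :\: C)|.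
Proof.
move=> se /subsetP CV /subsetP SV dCS sep; rewrite -[X in _ <= X]cardsUI; apply: leq_add.
  apply/subset_leq_card/subsetP => -[a b]; rewrite !inE /= => /and3P[aV bV eab].
  rewrite aV bV eab !andbT; case: (boolP (a \in C)) => aC /=.
    by have := sep a b aC bV eab; rewrite inE orbF.
  case: (boolP (b \in C)) => bC; rewrite ?orbT //= andbT orbF.
  by have := sep b a bC aV; rewrite se => /(_ eab); rewrite inE (negPf aC).
apply/subset_leq_card/subsetP => -[a b]; rewrite !inE /= => /and3P[aS bS ->].
by rewrite aS bS !orbT !SV // !(disjointFl dCS).
Qed.

Lemma low_degree (T : finType) (e : rel T) (V : {set T}) :
  #|edges e V| < 8 * #|V| -> exists2 v, v \in V & #|nbh e V v| < 8.
Proof.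
rewrite ltnNge => lt; apply/exists_inP; apply: contraNT lt => /exists_inPn deg.
rewrite card_edges mulnC -sum_nat_const; apply: leq_sum => x xV.
by rewrite leqNgt deg.
Qed.

(* [edges] counts ordered pairs, so it is even and the bound [17] stands for
   [4n - 8] edges; this [8] is the least constant for which two parts glued along a
   triangle are not both too sparse. *)
Theorem mader_K6 (T : finType) (e : rel T) (V : {set T}) :
    symmetric e -> irreflexive e -> 3 <= #|V| -> 8 * #|V| <= #|edges e V| + 17 ->
  exists B : 'I_6 -> {set T}, model e V B.
Proof.
(* The outer induction on the order serves contraction and separation, the inner one on the size
   serves edge deletion. *)
have [n] := ubnP #|V|; elim: n => // n IHn in e V *.
have [k] := ubnP #|edges e V|; elim: k => // k IHk in e *.
move=> ltk ltn se ire V3 dense.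
have nbh_lt x : x \in V -> #|nbh e V x| < #|V|.
  by move=> xV; rewrite (cardsD1 x V) xV; apply/subset_leq_card/nbhD1.
(* Three vertices carry at most 6 ordered pairs, but the bound asks for 7. Hence removing one vertex
   still leaves 3. *)
have V4 : 4 <= #|V|.
  rewrite ltn_neqAle V3 andbT; apply/eqP => V3'.
  have : #|edges e V| <= #|V| * 2.
    rewrite card_edges -sum_nat_const; apply: leq_sum => x /nbh_lt.
    by rewrite -V3'.
  by lia.
(* With at least [4n] edges one edge can be deleted within the bound; otherwise the average degree
   is below 8. *)
have [large|small] := leqP (8 * #|V|) #|edges e V|.
  have /card_gt0P[[a b] abV] : 0 < #|edges e V| by lia.
  move: (abV); rewrite inE /= => /and3P[aV bV eab].
  pose e' : rel T := [rel x y | e x y && ~~ ((x == a) && (y == b) || (x == b) && (y == a))].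
  have sub_e : subrel e' e by move=> x y /andP[].
  have se' : symmetric e'.
    by move=> x y; rewrite /e' /= se; congr (_ && ~~ _); rewrite orbC; congr orb; rewrite andbC.
  have dE : edges e' V = edges e V :\: [set (a, b); (b, a)].
    by apply/setP => -[x y]; rewrite !inE /= !xpair_eqE; case: (x \in V); case: (y \in V); rewrite ?andbF //= andbC.
  have cI : #|edges e V :&: [set (a, b); (b, a)]| + #|edges e' V| = #|edges e V|.
    by rewrite dE cardsID.
  have cI2 : #|edges e V :&: [set (a, b); (b, a)]| <= 2.
    by apply: leq_trans (subset_leq_card (subsetIr _ _)) _; rewrite cards2; case: (_ != _).
  have cI0 : 0 < #|edges e V :&: [set (a, b); (b, a)]|.
    by apply/card_gt0P; exists (a, b); rewrite in_setI abV !inE eqxx.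
  have ire' : irreflexive e' by move=> x; rewrite /e' /= ire.
  have lt' : #|edges e' V| < k by lia.
  have dense' : 8 * #|V| <= #|edges e' V| + 17 by lia.
  have [B mB] := IHk e' lt' ltn se' ire' V3 dense'.
  by exists B; apply: sub_model mB.
(* Contracting an edge in at most three triangles costs at most [2 * (3 + 1) = 8] ordered pairs,
   just what the bound drops by for one vertex. *)
case: (boolP [exists x in V, exists y in V, e x y && (#|nbh e V x :&: nbh e V y| < 4)]).
  case/exists_inP=> x xV /exists_inP[y yV /andP[exy lt4]].
  have xy : x != y by apply: contraTneq exy => ->; rewrite ire.
  have ce := contract_edges se ire xV yV exy.
  have cV := cardsD1 y V; rewrite yV in cV.
  have sc : symmetric (contract e x y).
    by move=> u w; rewrite /contract /= se; congr orb; rewrite orbC.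
  have irc : irreflexive (contract e x y).
    by move=> u; rewrite /contract /= ire; case: eqVneq.
  have lt' : #|V :\ y| < n by lia.
  have V3' : 3 <= #|V :\ y| by lia.
  have dense' : 8 * #|V :\ y| <= #|edges (contract e x y) (V :\ y)| + 17 by lia.
  have [B mB] := IHn _ _ lt' sc irc V3' dense'.
  exact: contract_model mB.
move=> /exists_inPn tri.
have triV x y : x \in V -> y \in V -> e x y -> 4 <= #|nbh e V x :&: nbh e V y|.
  move=> xV yV exy; rewrite leqNgt; apply: contra (tri x xV) => lt.
  by apply/exists_inP; exists y; rewrite ?exy.
case: (boolP [exists x in V, #|nbh e V x| == 0]) => [/exists_inP[x xV /eqP nx]|/exists_inPn pos].
  have de := edges_del V x se; have cV := cardsD1 x V; rewrite xV in cV.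
  have lt' : #|V :\ x| < n by lia.
  have V3' : 3 <= #|V :\ x| by lia.
  have dense' : 8 * #|V :\ x| <= #|edges e (V :\ x)| + 17 by rewrite nx in de; lia.
  have [B mB] := IHn e _ lt' se ire V3' dense'.
  by exists B; apply: sub_model mB; rewrite ?subD1set.
have deg5 x : x \in V -> 5 <= #|nbh e V x|.
  move=> xV; have := pos x xV; rewrite -lt0n => /card_gt0P[y].
  rewrite inE => /andP[yV exy]; apply: leq_ltn_trans (triV x y xV yV exy) _.
  apply: proper_card; apply/properP; split; first exact: subsetIl.
  by exists y; rewrite !inE ?ire ?andbF ?yV.
have [v vV v8] := low_degree small.
have v08 : 0 < #|nbh e V v| < 8 by rewrite v8 andbT (leq_trans _ (deg5 v vV)).
have [//|[C [S [CV C0 SN sep [clS S3]]]]] := K6_or_clique_separator se ire vV v08 triV.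
have CVv : C \subset V by apply: subset_trans CV (subsetDl _ _).
have SV : S \subset V by apply: subset_trans SN _; apply/subsetP => x /setIdP[].
have dCN x : x \in C -> x \notin v |: nbh e V v by move/(subsetP CV); rewrite inE => /andP[].
have dCS : [disjoint C & S].
  rewrite -setI_eq0; apply/eqP/setP => x; rewrite !inE; apply/andP => -[/dCN xC xS].
  by move: xC; rewrite in_setU1 (subsetP SN x xS) orbT.
have := edges_separation se CVv SV dCS sep; rewrite (card_edges_clique ire clS).
have vCS : v \notin C :|: S.
  rewrite inE negb_or; apply/andP; split; first by apply/negP => /dCN; rewrite !inE eqxx.
  by apply/negP => /(subsetP SN); rewrite inE ire andbF.
have ltA : #|C :|: S| < #|V|.
  apply: proper_card; apply/properP; split; first by rewrite subUset CVv.
  by exists v.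
have [c cC] : exists c, c \in C by apply/set0Pn.
(* Each side contains the whole neighbourhood of a vertex, of [c] here and of [v] below, hence at
   least 5 vertices. *)
have A3 : 3 <= #|C :|: S|.
  apply: leq_trans (_ : 5 <= _) => //; apply: leq_trans (deg5 c (subsetP CVv c cC)) _.
  by apply/subset_leq_card/subsetP => x; rewrite inE => /andP[xV]; apply: sep.
have B3 : 3 <= #|V :\: C|.
  apply: leq_trans (_ : 5 <= _) => //; apply: leq_trans (deg5 v vV) _.
  apply/subset_leq_card/subsetP => x xN; rewrite inE; case/setIdP: (xN) => -> _.
  by rewrite andbT; apply/negP => /dCN; rewrite in_setU1 xN orbT.
have cA : #|C :|: S| = #|C| + #|S|.
  by rewrite cardsU (eqP (_ : C :&: S == set0)) ?setI_eq0 // cards0 subn0.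
have C0' : 0 < #|C| by rewrite card_gt0.
have cB : #|V :\: C| = #|V| - #|C| by rewrite cardsD (setIidPr CVv).
have [dA|dA] := leqP (8 * #|C :|: S|) (#|edges e (C :|: S)| + 17).
  move=> _; have ltA' : #|C :|: S| < n by lia.
  have [B mB] := IHn e _ ltA' se ire A3 dA.
  by exists B; apply: sub_model mB; rewrite ?subUset ?CVv.
have [dB|dB] := leqP (8 * #|V :\: C|) (#|edges e (V :\: C)| + 17).
  move=> _; have ltB' : #|V :\: C| < n by lia.
  have [B mB] := IHn e _ ltB' se ire B3 dB.
  by exists B; apply: sub_model mB; rewrite ?subsetDl.
have cCV := subset_leq_card CVv.
(* If both sides miss the bound, then with [s = #|S|] the counts add up to
   [s * (s - 1) + 19 <= 8 * s]. This fails for all [s <= 3], though not for [s = 4]. *)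
move=> bound; exfalso; clear sep; move: #|S| S3 cA bound => [|[|[|[|s]]]] //; lia.
Qed.

(** * Colourings of critical and double-critical graphs *)

Lemma colorable_of (T C : finType) (e : rel T) (S : {set T}) k (f : T -> C) :
    #|C| <= k -> {in S &, forall x y, e x y -> f x != f y} -> colorable e S k.
Proof.
move=> Ck fP; apply/existsP; exists [ffun x => widen_ord Ck (enum_rank (f x))].
apply/forallP => x; apply/forallP => y; apply/implyP => /and3P[xS yS exy].
rewrite !ffunE; apply: contra (fP x y xS yS exy).
by move=> /eqP/(congr1 val)/= /val_inj/enum_rank_inj->.
Qed.

Lemma colorableP (T : finType) (e : rel T) (S : {set T}) k :
  colorable e S k ->
  exists f : T -> 'I_k, {in S &, forall x y, e x y -> f x != f y}.
Proof.
case/existsP => f /forallP fP; exists f => x y xS yS exy.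
by have /forallP/(_ y) := fP x; rewrite xS yS exy.
Qed.

Lemma chi_le (T : finType) (e : rel T) (ir : irreflexive e) (S : {set T}) k :
  (chi ir S <= k) = colorable e S k.
Proof.
rewrite /chi; case: ex_minnP => n cn nmin; apply/idP/idP => [nk|/nmin//].
have [f fP] := colorableP cn.
by apply: (colorable_of (f := f)) fP; rewrite card_ord.
Qed.

Lemma double_critical_triangles (T : finType) (e : rel T) (ir : irreflexive e) x y k :
    symmetric e -> double_critical ir -> chiG ir = k.+2 -> e x y ->
  k <= #|nbh e setT x :&: nbh e setT y|.
Proof.
move=> se [_ dc] chi6 exy; rewrite leqNgt; apply/negP => lt.
have := dc x y exy; rewrite chi6 subn2 chi_le => /colorableP[f fP].
have xy : x != y by apply: contraTneq exy => ->; rewrite ir.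
(* Fewer than [k] common neighbours cannot use all [k] colours. *)
have [c cN] : exists c, c \notin [set f z | z in nbh e setT x :&: nbh e setT y].
  apply/existsP; rewrite -negb_forall; apply: contraL lt => /forallP cover.
  rewrite -leqNgt -[X in X <= _]card_ord -cardsT.
  apply: leq_trans (leq_imset_card f _); apply/subset_leq_card/subsetP => c _.
  exact: cover.
have cxy z : f z = c -> e x z -> ~~ e y z.
  move=> fz exz; apply: contra cN => eyz; apply/imsetP; exists z => //.
  by rewrite !inE exz.
(* The fresh colour [None] goes to [y] and to the neighbours of [x] coloured [c]. These are
   independent: the latter share a colour of [f], and by [cxy] none is adjacent to [y]. *)
pose moved z := (z == y) || (f z == c) && e x z.
pose g z := if z == x then Some c else if moved z then None else Some (f z).
suff: colorable e setT k.+1 by rewrite -(chi_le ir) -/(chiG ir) chi6 ltnn.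
apply: (colorable_of (f := g)) => [|u w _ _]; first by rewrite card_option card_ord.
have fuw u' w' : u' \notin [set x; y] -> w' \notin [set x; y] -> e u' w' -> f u' != f w'.
  by move=> uN wN euw; apply: fP; rewrite ?in_setC.
wlog wx : u w / w != x => [H euw|euw].
  case: (eqVneq w x) => [wx|]; last by move=> wx; apply: H.
  rewrite eq_sym; apply: H; last by rewrite se.
  by apply: contraTneq euw => ->; rewrite wx ir.
rewrite /g (negPf wx); case: (eqVneq u x) => [ux|ux].
  rewrite /moved -ux euw andbT; case: (w == y) => //=; case: (eqVneq (f w) c) => //= fw.
  by rewrite eq_sym.
case mu: (moved u); case mw: (moved w) => //; last first.
  move: mu mw; rewrite /moved => /negbT; rewrite negb_or => /andP[uy _].
  move/negbT; rewrite negb_or => /andP[wy _].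
  by apply: contra (fuw u w _ _ euw); [move=> /eqP[->] | rewrite !inE negb_or ux | rewrite !inE negb_or wx].
exfalso; case/orP: mu => [/eqP uy|/andP[/eqP fu exu]]; case/orP: mw => [/eqP wy|/andP[/eqP fw exw]].
- by rewrite uy wy ir in euw.
- by have := cxy w fw exw; rewrite -uy euw.
- by have := cxy u fu exu; rewrite -wy se euw.
(* The value of [f] at [y] is arbitrary and may be [c], so [y] is ruled out before [f] is used as a
   proper colouring. *)
have neq_y z : e x z -> f z = c -> e z y -> False.
  by move=> exz fz ezy; have := cxy z fz exz; rewrite se ezy.
have [uy|uy] := eqVneq u y; first by apply: (neq_y w) => //; rewrite -uy se.
have [wy|wy] := eqVneq w y; first by apply: (neq_y u) => //; rewrite -wy.
have := fuw u w; rewrite !inE !negb_or ux uy wx wy euw fu fw eqxx.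
by move=> /(_ isT isT isT).
Qed.

(** Renames colours so that two colourings agree on a clique. One transposition per vertex corrects
    its colour and, by injectivity, leaves those already matched. *)
Lemma perm_of_injections (T C : finType) (f g : T -> C) (s : seq T) :
  uniq (map f s) -> uniq (map g s) -> exists p : {perm C}, {in s, forall x, p (f x) = g x}.
Proof.
elim: s => [_ _|x s IH /= /andP[fx fs] /andP[gx gs]]; first by exists 1%g.
have [p pP] := IH fs gs; exists (p * tperm (p (f x)) (g x))%g => z.
rewrite inE permM => /orP[/eqP->|zs]; first by rewrite tpermL.
rewrite (pP z zs) tpermD //.
  by apply: contraNneq fx => e; apply/mapP; exists z => //; apply: (@perm_inj _ p); rewrite e (pP z zs).
by apply: contraNneq gx => ->; apply: map_f.
Qed.

(** Colour [C :|: S] as in [G - v] and the rest as in [G - c] with some [c] in [C]. After renaming,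
    the two colourings agree on the clique [S] and glue to one of [G] with too few colours. *)
Lemma critical_no_clique_separator (T : finType) (e : rel T) (ir : irreflexive e)
    v (C S : {set T}) k :
    symmetric e -> critical ir -> chiG ir = k.+1 -> ~ clique_separator e setT v C S.
Proof.
move=> se crit chik [CV /set0Pn[c cC] SN sep [clS _]].
have col w : colorable e (~: [set w]) k.
  by rewrite -(chi_le ir) -ltnS -chik; apply: crit.
have [f1 f1P] := colorableP (col v); have [f2 f2P] := colorableP (col c).
have vC : v \notin C by apply/negP => /(subsetP CV); rewrite !inE eqxx.
have vS : v \notin S by apply/negP => /(subsetP SN); rewrite inE ir andbF.
have CS x : x \in S -> x \notin C.
  move=> xS; apply/negP => /(subsetP CV); rewrite in_setD in_setU1.
  by rewrite (subsetP SN x xS) orbT.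
have nv x : x \in C :|: S -> x \in ~: [set v].
  by rewrite in_setC in_set1; apply: contraTneq => ->; rewrite inE negb_or vC.
have nc x : x \notin C -> x \in ~: [set c].
  by rewrite in_setC in_set1; apply: contraNneq => ->.
have inj_on (f : T -> 'I_k) : {in S &, forall x y, e x y -> f x != f y} ->
    uniq (map f (enum S)).
  move=> fP; rewrite map_inj_in_uniq ?enum_uniq // => x y.
  rewrite !mem_enum => xS yS; apply: contra_eq => xy.
  exact/fP/clS.
have [p pP] : exists p : {perm 'I_k}, {in enum S, forall x, p (f2 x) = f1 x}.
  apply: perm_of_injections; apply: inj_on => x y xS yS exy.
    by apply: f2P => //; apply/nc/CS.
  by apply: f1P => //; apply: nv; rewrite inE ?xS ?yS orbT.
pose g x := if x \in C then f1 x else p (f2 x).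
suff: colorable e setT k by rewrite -(chi_le ir) -/(chiG ir) chik ltnn.
have gC x y : x \in C -> e x y -> g x != g y.
  move=> xC exy; have yCS := sep x y xC (in_setT y) exy.
  have -> : g y = f1 y.
    by rewrite /g; case: ifP yCS => // yC; rewrite inE yC => yS; rewrite pP ?mem_enum.
  by rewrite /g xC; apply: f1P => //; apply: nv => //; rewrite inE xC.
apply: (colorable_of (f := g)) => [|x y _ _ exy]; first by rewrite card_ord.
case: (boolP (x \in C)) => [xC|xC]; first exact: gC.
case: (boolP (y \in C)) => [yC|yC]; first by rewrite eq_sym; apply: gC; rewrite // se.
by rewrite /g (negPf xC) (negPf yC) (inj_eq perm_inj); apply: f2P => //; apply: nc.
Qed.

(** * Assembling the dense and the sparse case *)

Theorem theorem22 (T : finType) (e : rel T) (sym : symmetric e) (ir : irreflexive e) :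
  double_critical ir -> chiG ir = 6 -> has_Kn_minor e 6.
Proof.
move=> dc chi6.
suff [B [Bne cB dB tB]] : exists B : 'I_6 -> {set T}, model e setT B.
  by exists B; split=> // i; have /andP[] := Bne i.
have T6 : 6 <= #|[set: T]|.
  rewrite cardsT -chi6 chi_le; apply: (colorable_of (f := id)) => // x y _ _.
  by apply: contraTneq => ->; rewrite ir.
have [dense|sparse] := leqP (8 * #|[set: T]|) #|edges e setT|.
  apply: mader_K6 => //; first exact: leq_trans T6.
  exact: leq_trans dense (leq_addr _ _).
have [v vT v8] := low_degree sparse; have [crit _] := dc.
(* If [v] were isolated, a 5-colouring of [G - v] would be proper on [G] whatever its value at
   [v]. *)
have v0 : 0 < #|nbh e setT v|.
  rewrite lt0n; apply/negP => /eqP/cards0_eq nv.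
  have iso x : e v x = false by apply/negP => evx; have := in_set0 x; rewrite -nv !inE evx.
  have := crit v; rewrite chi6 ltnS chi_le => /colorableP[f fP].
  suff: colorable e setT 5 by rewrite -(chi_le ir) -/(chiG ir) chi6.
  apply: (colorable_of (f := f)) => [|x y _ _ exy]; first by rewrite card_ord.
  by apply: fP => //; rewrite !inE; apply: contraTneq exy => ->; rewrite ?iso // sym iso.
have tri x y : x \in setT -> y \in setT -> e x y ->
    4 <= #|nbh e setT x :&: nbh e setT y|.
  by move=> _ _; apply: double_critical_triangles sym dc chi6.
have v08 : 0 < #|nbh e setT v| < 8 by rewrite v0.
have [//|[C [S sep]]] := K6_or_clique_separator sym ir vT v08 tri.
by case: (critical_no_clique_separator sym crit chi6 sep).
Qed.
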